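(* Let $(\mathcal{X},\mathcal{B},\mu)$ be a probability space, let $\mathcal{E}\colon\mathrm{Dom}(\mathcal{E})\times\mathrm{Dom}(\mathcal{E})\to\mathbb{R}$ be a nonnegative definite symmetric bilinear form, and let $\Gamma\colon\mathcal{A}\times\mathcal{A}\to L_0(\mathcal{X},\mu)$, where $\mathcal{A}\subseteq\mathrm{Dom}(\mathcal{E})$ is a linear subspace, be a symmetric bilinear map with $\Gamma(f,f)\ge0$ such that $\mathcal{E}(f,g)=\int_{\mathcal{X}}\Gamma(f,g)\,d\mu$ for $f,g\in\mathcal{A}$. Suppose that Assumptions A and B (see context) are satisfied and that for all $p\in(1,2]$ the Beckner inequality $$\alpha_p\bigl(\mu(f^p)-\mu(f)^p\bigr)\le \frac p2\,\mathcal{E}(f,f^{p-1})\quad\text{for all nonnegative } f\in\mathrm{Dom}(\mathcal{E}) \text{ with } f^{p-1}\in\mathrm{Dom}(\mathcal{E})$$ holds with $\alpha_p\ge a(p-1)^s$ for some $a>0$, $s\ge0$. Then for all $f\in\mathcal{A}$ and $r\ge2$, $$\|f-\mu(f)\|_r^2\le\frac{r^{s+1}\kappa(s)}{a}\,\|\Gamma(f)\|_{r/2},$$ where $\kappa(s)=(1-e^{-(s+1)/2})^{-1}$.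
   Context: $L_0(\mathcal{X},\mu)$ is the space of $\mathcal{B}$-measurable real functions on $\mathcal{X}$; $\mathrm{Dom}(\mathcal{E})$ is a linear subspace of $L_0(\mathcal{X},\mu)$. Notation: $\mu(f)=\int_{\mathcal{X}} f\,d\mu$, $\|g\|_r=(\mu(|g|^r))^{1/r}$ (with the usual meaning for $r=\infty$), $\Gamma(f)=\Gamma(f,f)$. Assumption A: (1) if $\varphi\colon\mathbb{R}\to\mathbb{R}$ is a contraction (1-Lipschitz) and $f\in\mathrm{Dom}(\mathcal{E})$, then $\varphi\circ f\in\mathrm{Dom}(\mathcal{E})$; (2) for any $f_1,f_2,g_1,g_2\in\mathrm{Dom}(\mathcal{E})$, if $(f_1(x)-f_1(y))(f_2(x)-f_2(y))\le (g_1(x)-g_1(y))(g_2(x)-g_2(y))$ for all $x,y\in\mathcal{X}$, then $\mathcal{E}(f_1,f_2)\le\mathcal{E}(g_1,g_2)$. Assumption B: (1) for any bounded $f\in\mathcal{A}$, any $c\in\mathbb{R}$ and any $\gamma>1$, $t\ge1$, $\mathcal{E}(|f+c|^\gamma,|f+c|)\le 2\gamma\,\bigl\||f+c|^{\gamma-1}\bigr\|_{t/(t-1)}\,\|\Gamma(f)\|_t$; (2) for any $f\in\mathcal{A}$ there exists a sequence $f_n$ of bounded elements of $\mathcal{A}$ such that $f_n\to f$ and $\Gamma(f_n)\le\Gamma(f)$ $\mu$-a.s. Convention: an estimate $A\le B$ means ''if the right-hand side is finite, then the left-hand side is well-defined and the inequality holds''. *)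

(* Defs.v *)
From HB Require Import structures.
From mathcomp Require Import all_boot all_order all_algebra.
From mathcomp Require Import all_classical all_reals all_analysis.

Set Implicit Arguments.
Unset Strict Implicit.
Unset Printing Implicit Defensive.
Import Order.TTheory GRing.Theory Num.Theory.
Import numFieldNormedType.Exports.

Local Open Scope classical_set_scope.
Local Open Scope ring_scope.

(* Reading of an estimate [A <= B]: as soon as [B] is finite, [A] is
   well defined (this is [wd]) and the inequality holds. *)
Definition estimate (R : realType) (wd : Prop) (A B : \bar R) : Prop :=
  B \is a fin_num -> wd /\ (A <= B)%E.

Section forms.
Context {d : measure_display} {T : measurableType d} {R : realType}.
Implicit Types (f g h : T -> R).

(* Elements of L_0 are genuine functions, not classes modulo a.e. equality:
   the comparison axiom [assumptionA] involves their values at all points. *)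
Definition L0 : set (T -> R) := [set f | measurable_fun [set: T] f].

Definition linear_subspace (D : set (T -> R)) : Prop :=
  GRing.submod_closed (mem D : {pred (T -> R)}).

(* Forms are total in Rocq; only their values on [D] are constrained or used.
   Linearity in the second argument follows by symmetry. *)
Definition symmetric_bilinear (V : lmodType R) (D : set (T -> R))
    (B : (T -> R) -> (T -> R) -> V) : Prop :=
  (forall f g, D f -> D g -> B f g = B g f) /\
  (forall (a : R) f g h, D f -> D g -> D h ->
     B (a *: f + g) h = a *: B f h + B g h).

Definition nonneg_symmetric_form (D : set (T -> R))
    (E : (T -> R) -> (T -> R) -> R) : Prop :=
  symmetric_bilinear (V := R^o) D E /\ (forall f, D f -> 0 <= E f f).

Definition nonneg_symmetric_operator (A : set (T -> R))
    (Gamma : (T -> R) -> (T -> R) -> (T -> R)) : Prop :=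
  [/\ forall f g, A f -> A g -> L0 (Gamma f g),
      symmetric_bilinear A Gamma
    & forall f, A f -> forall x, 0 <= Gamma f f x].

Definition represents (mu : probability T R) (A : set (T -> R))
    (Gamma : (T -> R) -> (T -> R) -> (T -> R))
    (E : (T -> R) -> (T -> R) -> R) : Prop :=
  forall f g, A f -> A g ->
    mu.-integrable [set: T] (EFin \o Gamma f g) /\
    E f g = \int[mu]_x Gamma f g x.

Definition assumptionA (D : set (T -> R))
    (E : (T -> R) -> (T -> R) -> R) : Prop :=
  (forall (phi : R -> R) f, 1.-lipschitz phi -> D f -> D (phi \o f)) /\
  (forall f1 f2 g1 g2, D f1 -> D f2 -> D g1 -> D g2 ->
     (forall x y,
        (f1 x - f1 y) * (f2 x - f2 y) <= (g1 x - g1 y) * (g2 x - g2 y)) ->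
     E f1 f2 <= E g1 g2).

(* [hoelder_conjugate t%:E] is t / (t - 1), and +oo for t = 1. *)
Definition assumptionB (mu : probability T R) (D A : set (T -> R))
    (Gamma : (T -> R) -> (T -> R) -> (T -> R))
    (E : (T -> R) -> (T -> R) -> R) : Prop :=
  (forall f (c gamma t : R), A f -> bounded_fun f -> 1 < gamma -> 1 <= t ->
     estimate (D (fun x => `|f x + c| `^ gamma) /\ D (fun x => `|f x + c|))
       (E (fun x => `|f x + c| `^ gamma) (fun x => `|f x + c|))%:E
       ((2 * gamma)%:E *
        'N[mu]_(hoelder_conjugate t%:E)[EFin \o (fun x => `|f x + c| `^ (gamma - 1))%R] *
        'N[mu]_(t%:E)[EFin \o Gamma f f])%E) /\
  (forall f, A f -> exists fn : nat -> T -> R,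
     [/\ forall n, A (fn n) /\ bounded_fun (fn n),
         \forall x \ae mu, fn n x @[n --> \oo] --> f x
       & forall n, \forall x \ae mu, Gamma (fn n) (fn n) x <= Gamma f f x]).

(* The right-hand side of the inequality is always finite, so the integrals
   on its left-hand side are required to converge. *)
Definition beckner (mu : probability T R) (D : set (T -> R))
    (E : (T -> R) -> (T -> R) -> R) (p alpha : R) : Prop :=
  forall f, D f -> (forall x, 0 <= f x) -> D (fun x => f x `^ (p - 1)) ->
    [/\ mu.-integrable [set: T] (EFin \o f),
        mu.-integrable [set: T] (fun x => (f x `^ p)%:E)
      & alpha * ((\int[mu]_x (f x `^ p)) - (\int[mu]_x f x) `^ p)
        <= p / 2 * E f (fun x => f x `^ (p - 1))].

End forms.

Definition kappa (R : realType) (s : R) : R :=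
  (1 - expR (- ((s + 1) / 2)))^-1.

(* Main.v *)
(** For bounded [f] put [g = |f - mu(f)|] and let [M q] be its moment of order
    [q].  Applied to [g ^ (q - 1)] with [p = q / (q - 1)], the Beckner inequality
    and Assumption B give, for [q > 2],
      [M q - (M (q - 1)) ^ (q / (q - 1))
         <= q (q - 1)^s / a * (M q) ^ (1 - 2 / q) * ||Gamma(f)||_{q/2}],
    and the bound on [(M q) ^ (2 / q)] follows by induction from [q - 1] to [q],
    since [(1 - 1/q) ^ ((s + 1) q / 2) <= exp (- (s + 1) / 2) = 1 - 1 / kappa s].
    For [q <= 2] it comes from the Beckner inequality with [p = 2], a spectral gap.

    A general [f] is a limit of bounded [f_n]. The spectral gap bounds the
    variance of [|f_n - f|] uniformly in [n], hence [f_n] tends to [f] in mean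
    and the means converge; Fatou's lemma concludes. *)

Require Import Defs.
From HB Require Import structures.
From mathcomp Require Import all_boot all_order all_algebra.
From mathcomp Require Import all_classical all_reals all_analysis.
From mathcomp Require Import measurable_realfun.
From mathcomp Require Import ring lra.

Set Implicit Arguments.
Unset Strict Implicit.
Unset Printing Implicit Defensive.
Import Order.TTheory GRing.Theory Num.Theory.
Import numFieldNormedType.Exports.

Local Open Scope classical_set_scope.
Local Open Scope ring_scope.

(** * Power inequalities and the arithmetic of one induction step *)

Lemma powR_young (R : realType) (x B p q : R) : 0 <= x -> 0 < B ->
  0 < p <= q ->
  x `^ p <= B `^ p * (1 - p / q) + p / q * (B `^ p / B `^ q) * x `^ q.
Proof.
move=> x0 B0 /andP[p0]; rewrite le_eqVlt => /predU1P[<-|pq].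
  have Bp : B `^ p != 0 by rewrite gt_eqF// powR_gt0.
  have p_neq0 : p != 0 by rewrite gt_eqF.
  by rewrite (divff Bp) (divff p_neq0) subrr mulr0 add0r !mul1r.
have q0 : 0 < q by exact: lt_trans pq.
have qp0 : 0 < q - p by rewrite subr_gt0.
have h : (q / (q - p))^-1 + (q / p)^-1 = 1.
  by field; rewrite !gt_eqF.
(* Young's inequality for the product of [1] and [(x / B) ^ p], with conjugate exponents
   [q / (q - p)] and [q / p]; the outcome is an equality at [x = B]. *)
have := conjugate_powR (ler01) (powR_ge0 (x / B) p)
  (divr_gt0 q0 qp0) (divr_gt0 q0 p0) h.
rewrite mul1r powR1 -powRrM [p * _]mulrC divfK ?gt_eqF//.
have dE r : (x / B) `^ r = x `^ r / B `^ r.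
  have xE : x = (x / B) * B by rewrite divfK ?gt_eqF.
  rewrite [in RHS]xE [in RHS]powRM ?divr_ge0 ?(ltW B0)// mulfK//.
  by rewrite gt_eqF// powR_gt0.
rewrite !dE ler_pdivrMr ?powR_gt0// => /le_trans; apply.
rewrite le_eqVlt; apply/orP; left; apply/eqP.
have Bq : B `^ q != 0 by rewrite gt_eqF// powR_gt0.
by field; rewrite Bq !gt_eqF.
Qed.

(** Lyapunov's monotonicity of norms, obtained by integrating [powR_young]. As that bound is sharp
    at [x = B], no constant is lost. Integrals stay extended real, so integrability never has to be
    checked. *)
Lemma moment_le d (T : measurableType d) (R : realType)
    (mu : probability T R) (g : T -> R) (B p q : R) :
  measurable_fun [set: T] g -> (forall x, 0 <= g x) -> 0 < B -> 0 < p <= q ->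
  (\int[mu]_x (g x `^ q)%:E <= (B `^ q)%:E ->
   \int[mu]_x (g x `^ p)%:E <= (B `^ p)%:E)%E.
Proof.
move=> mg g0 B0 /andP[p0 pq] hq.
have q0 : 0 < q by exact: lt_le_trans pq.
have mgr r : measurable_fun [set: T] (fun x => (g x `^ r)%:E : \bar R).
  by apply/measurable_EFinP; exact: (measurableT_comp (measurable_powR r)).
set K1 := B `^ p * (1 - p / q); set K2 := p / q * (B `^ p / B `^ q).
have K10 : 0 <= K1.
  by rewrite mulr_ge0 ?powR_ge0// subr_ge0 ler_pdivrMr// mul1r.
have K20 : 0 <= K2 by rewrite !mulr_ge0 ?invr_ge0 ?powR_ge0// ltW.
apply: (@le_trans _ _ (\int[mu]_x (K1%:E + K2%:E * (g x `^ q)%:E))%E).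
  apply: ge0_le_integral => //.
  - by move=> x _; rewrite lee_fin powR_ge0.
  - by apply: emeasurable_funD => //; exact: emeasurable_funM.
  - move=> x _; rewrite -EFinM -EFinD lee_fin.
    by apply: powR_young => //; rewrite p0.
rewrite ge0_integralD//; last 2 first.
  - by move=> x _; rewrite -EFinM lee_fin mulr_ge0 ?powR_ge0.
  - exact: emeasurable_funM.
rewrite ge0_integralZl_EFin//; last by move=> x _; rewrite lee_fin powR_ge0.
rewrite integral_cst//= [X in (_ * X + _)%E]probability_setT mule1.
apply: (@le_trans _ _ (K1%:E + K2%:E * (B `^ q)%:E)%E).
  by rewrite leeD2l// lee_wpmul2l.
rewrite -EFinM -EFinD lee_fin le_eqVlt; apply/orP; left; apply/eqP.
have Bq : B `^ q != 0 by rewrite gt_eqF// powR_gt0.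
by rewrite /K1 /K2; field; rewrite Bq gt_eqF.
Qed.

(** By contradiction, with [e = exp (- (s + 1) / 2)]: if [M > b ^ (q / 2)], then [M ^ (2 / q) >= b],
    so the term in [c] is at most [(1 - e) * M]. The term in [M'] is at most [e * b ^ (q / 2)], and
    together they force [e * M <= e * b ^ (q / 2)]. *)
Lemma moment_step (R : realType) (q s b b' c M M' : R) :
  2 < q -> 0 <= s -> 0 < b -> b' = ((q - 1) / q) `^ (s + 1) * b ->
  0 <= M -> 0 <= M' -> M' <= b' `^ ((q - 1) / 2) ->
  M - M' `^ (q / (q - 1)) <= c * M `^ ((q - 2) / q) ->
  0 <= c <= (1 - expR (- ((s + 1) / 2))) * b ->
  M <= b `^ (q / 2).
Proof.
move=> q2 s0 b0 b'E M0 M'0 hM' hM /andP[c0 hc].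
have q0 : 0 < q by lra.
have q10 : 0 < q - 1 by lra.
set e := expR _ in hc; have e0 : 0 < e by exact: expR_gt0.
have b'0 : 0 < b' by rewrite b'E mulr_gt0// powR_gt0// divr_gt0.
have B0 : 0 < b `^ (q / 2) by rewrite powR_gt0.
have h1 : M' `^ (q / (q - 1)) <= e * b `^ (q / 2).
  apply: (@le_trans _ _ (b' `^ (q / 2))).
    have -> : q / 2 = (q - 1) / 2 * (q / (q - 1)) by field; rewrite gt_eqF.
    rewrite [leRHS]powRrM ge0_ler_powR ?nnegrE ?powR_ge0// divr_ge0//; exact: ltW.
  rewrite b'E powRM ?powR_ge0 ?(ltW b0)// ler_pM2r// -powRrM.
  rewrite /e /powR gt_eqF ?divr_gt0// ler_expR.
  (* This is [1 - 1 / q <= exp (- 1 / q)]; the exponent [(s + 1) * q / 2] then cancels [q]. *)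
  have lq : ln ((q - 1) / q) <= - q^-1.
    have -> : (q - 1) / q = 1 + - q^-1 by field; rewrite gt_eqF.
    have q1 : 0 < 1 + - q^-1 by rewrite subr_gt0 invf_lt1//; lra.
    by rewrite -[leRHS]expRK ler_ln ?posrE ?expR_gt0// expR_ge1Dx.
  apply: (@le_trans _ _ ((s + 1) * (q / 2) * - q^-1)).
    by rewrite ler_wpM2l// mulr_ge0//; lra.
  by rewrite le_eqVlt; apply/orP; left; apply/eqP; field; rewrite gt_eqF.
rewrite leNgt; apply/negP => Mb.
have M_gt0 : 0 < M by exact: lt_trans Mb.
have h2 : c * M `^ ((q - 2) / q) <= (1 - e) * M.
  have -> : (q - 2) / q = 1 - 2 / q by field; rewrite gt_eqF.
  rewrite powRB; last by rewrite (gt_eqF M_gt0) implybT.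
  rewrite powRr1// mulrA ler_pdivrMr ?powR_gt0//.
  rewrite [leRHS]mulrAC ler_pM2r// (le_trans hc)// ler_wpM2l//.
    rewrite subr_ge0 -[leRHS]expR0 ler_expR; lra.
  have -> : b = (b `^ (q / 2)) `^ (2 / q).
    rewrite -powRrM (_ : q / 2 * (2 / q) = 1) ?powRr1 ?(ltW b0)//.
    by field; rewrite gt_eqF.
  by rewrite ge0_ler_powR ?nnegrE ?(ltW Mb) ?(ltW B0)// divr_ge0// ltW.
have : e * M <= e * b `^ (q / 2) by lra.
by rewrite ler_pM2l// leNgt Mb.
Qed.

(** * Integrals and variance on a probability space *)

Lemma EFin_Rintegral d (T : measurableType d) (R : realType)
    (mu : probability T R) (f : T -> R) :
  mu.-integrable [set: T] (EFin \o f) ->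
  (\int[mu]_x f x)%:E = (\int[mu]_x (f x)%:E)%E.
Proof. by move=> intf; rewrite fineK//; exact: integrable_fin_num. Qed.

Lemma Rintegral_probability_cst d (T : measurableType d) (R : realType)
    (mu : probability T R) (c : R) : \int[mu]_x c = c.
Proof.
rewrite Rintegral_cst// -[RHS]mulr1; congr (_ * _).
by rewrite -[RHS]/(fine 1%:E); congr fine; exact: probability_setT.
Qed.

Lemma bounded_integrable d (T : measurableType d) (R : realType)
    (mu : probability T R) (f : T -> R) (K : R) :
  measurable_fun [set: T] f -> (forall x, `|f x| <= K) ->
  mu.-integrable [set: T] (EFin \o f).
Proof.
move=> mf fK; apply: (@le_integrable _ _ _ _ _ measurableT _ (cst K%:E)).
- exact/measurable_EFinP.
- by move=> x _ /=; rewrite lee_fin (le_trans (fK x))// ler_norm.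
- exact: finite_measure_integrable_cst.
Qed.

Lemma variance_expansion d (T : measurableType d) (R : realType)
    (mu : probability T R) (f : T -> R) (m := \int[mu]_x f x) :
  mu.-integrable [set: T] (EFin \o f) ->
  mu.-integrable [set: T] (EFin \o (fun x => f x ^+ 2)) ->
  mu.-integrable [set: T] (EFin \o (fun x => (f x - m) ^+ 2)) /\
  \int[mu]_x (f x - m) ^+ 2 = \int[mu]_x (f x ^+ 2) - m ^+ 2.
Proof.
move=> if1 if2.
have ic c : mu.-integrable [set: T] (EFin \o (fun=> c)).
  exact: finite_measure_integrable_cst.
have i1 : mu.-integrable [set: T] (EFin \o (fun x => (- (2 * m)) * f x)).
  by have := integrableZl measurableT (- (2 * m)) if1.
have i2 : mu.-integrable [set: T]
    (EFin \o (fun x => (- (2 * m)) * f x + m ^+ 2)).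
  by have := integrableD measurableT i1 (ic (m ^+ 2)).
have i3 : mu.-integrable [set: T]
    (EFin \o (fun x => f x ^+ 2 + ((- (2 * m)) * f x + m ^+ 2))).
  by have := integrableD measurableT if2 i2.
have fE x : f x ^+ 2 + ((- (2 * m)) * f x + m ^+ 2) = (f x - m) ^+ 2 by ring.
split; first by under eq_fun do rewrite -fE.
under eq_Rintegral do rewrite -fE.
rewrite RintegralD// RintegralD// RintegralZl// Rintegral_probability_cst.
by rewrite -/m; ring.
Qed.

(** * Consequences of Assumption A, and the spectral gap *)

Section beckner.
Context d (T : measurableType d) (R : realType) (mu : probability T R)
  (DomE : set (T -> R)) (E : (T -> R) -> (T -> R) -> R).
Hypotheses (hDomL0 : DomE `<=` L0) (hypA : assumptionA DomE E).

Lemma Dom_contraction (phi : R -> R) f :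
  (forall x y, `|phi x - phi y| <= `|x - y|) -> DomE f -> DomE (phi \o f).
Proof.
by move=> hphi; apply: hypA.1 => -[x y] _ /=; rewrite mul1r; exact: hphi.
Qed.

Lemma Dom_shift f (c : R) : DomE f -> DomE (fun x => f x + c).
Proof.
by apply: (@Dom_contraction (fun y => y + c)) => x y; rewrite opprD addrACA subrr addr0.
Qed.

Lemma Dom_norm f : DomE f -> DomE (fun x => `|f x|).
Proof. apply: (@Dom_contraction Num.norm) => x y; exact: ler_dist_dist. Qed.

Lemma energy_norm f : DomE f -> E (fun x => `|f x|) (fun x => `|f x|) <= E f f.
Proof.
move=> Df; apply: hypA.2 => //; try exact: Dom_norm.
move=> x y; rewrite -!expr2 -[leLHS]real_normK ?num_real//.
rewrite -[leRHS]real_normK ?num_real// ler_sqr ?nnegrE//.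
exact: ler_dist_dist.
Qed.

Variables (a alpha2 : R).
Hypotheses (a0 : 0 < a) (ha : a <= alpha2) (hB : beckner mu DomE E 2 alpha2).

(** For [p = 2] the Beckner inequality reads [alpha2 * Var v <= E v v]. It also supplies
    integrability, so [v] may be unbounded. *)
Lemma ge0_spectral_gap v : DomE v -> (forall x, 0 <= v x) ->
  [/\ mu.-integrable [set: T] (EFin \o v),
      mu.-integrable [set: T] (EFin \o (fun x => (v x - \int[mu]_y v y) ^+ 2)) &
      \int[mu]_x (v x - \int[mu]_y v y) ^+ 2 <= E v v / a].
Proof.
move=> Dv v0.
have v1 : (fun x => v x `^ (2 - 1)) = v.
  apply/funext => x; rewrite (_ : 2 - 1 = 1 :> R) ?powRr1//; ring.
have v2 x : v x `^ 2 = v x ^+ 2 by rewrite powR_mulrn.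
have := hB Dv v0; rewrite v1 => /(_ Dv)[iv].
under eq_fun do rewrite v2; under eq_Rintegral do rewrite v2.
rewrite powR_mulrn ?Rintegral_ge0// divff ?pnatr_eq0// mul1r => iv2.
have [ivm <-] := variance_expansion iv iv2; move=> h; split => //.
rewrite ler_pdivlMr// mulrC (le_trans _ h)// ler_wpM2r//.
by apply: Rintegral_ge0 => x _; exact: sqr_ge0.
Qed.

(** The Beckner inequality concerns nonnegative functions, so [u] is shifted by its bound [K]. The
    shift preserves the variance and all increments, and Assumption A compares energies through
    increments. *)
Lemma bounded_spectral_gap u (K : R) : DomE u -> (forall x, `|u x| <= K) ->
  \int[mu]_x (u x - \int[mu]_y u y) ^+ 2 <= E u u / a.
Proof.
move=> Du uK; have iu := bounded_integrable mu (hDomL0 Du) uK.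
have v0 x : 0 <= u x + K by have := uK x; rewrite ler_norml => /andP[]; lra.
have [_ _] := ge0_spectral_gap (Dom_shift K Du) v0.
rewrite RintegralD//; last exact: finite_measure_integrable_cst.
rewrite Rintegral_probability_cst.
under eq_Rintegral do rewrite opprD addrACA subrr addr0.
move=> /le_trans; apply; rewrite ler_pM2r ?invr_gt0//.
apply: hypA.2 => //; try exact: Dom_shift.
by move=> x y; rewrite (_ : u x + K - (u y + K) = u x - u y)//; ring.
Qed.

End beckner.

(** * Norms, moments and the constant [kappa] *)

Lemma bounded_funW (T : Type) (R : realType) (f : T -> R) :
  bounded_fun f -> exists K : R, forall x, `|f x| <= K.
Proof.
move=> [M [_ /(_ (M + 1))]]; rewrite ltrDl ltr01 => /(_ isT) fM.
by exists (M + 1) => x; exact: fM.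
Qed.

Lemma LnormE d (T : measurableType d) (R : realType) (mu : probability T R)
    (h : T -> R) (p : R) : (forall x, 0 <= h x) ->
  'N[mu]_(p%:E)[EFin \o h]%E = ((\int[mu]_x (h x `^ p)%:E) `^ p^-1)%E.
Proof.
move=> h0; rewrite unlock; congr poweR; apply: eq_integral => x _ /=.
by rewrite ger0_norm.
Qed.

Lemma Lnorm_le d (T : measurableType d) (R : realType) (mu : probability T R)
    (h : T -> R) (p G : R) : (forall x, 0 <= h x) -> 0 < p -> 0 <= G ->
  (\int[mu]_x (h x `^ p)%:E <= (G `^ p)%:E ->
   'N[mu]_(p%:E)[EFin \o h] <= G%:E)%E.
Proof.
move=> h0 p0 G0 hG; rewrite LnormE//.
have -> : (G%:E = (G `^ p)%:E `^ p^-1)%E.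
  by rewrite poweR_EFin -powRrM divff ?gt_eqF// powRr1.
apply: gt0_ler_poweR => //; first by rewrite invr_ge0 ltW.
- rewrite in_itv/= leey andbT integral_ge0// => x _.
  by rewrite lee_fin powR_ge0.
- by rewrite in_itv/= leey andbT lee_fin powR_ge0.
Qed.

Lemma kappa_ge1 (R : realType) (s : R) : 0 <= s -> 1 <= kappa s.
Proof.
move=> s0; rewrite /kappa invf_ge1 ?subr_gt0 ?lerBlDr ?lerDl ?expR_ge0//.
by rewrite -[ltRHS]expR0 ltr_expR oppr_lt0 divr_gt0// ltr_wpDl.
Qed.

(** * Moment bounds for bounded functions *)

Section bounded.
Context (d : measure_display) (T : measurableType d)
    (R : realType) (mu : probability T R)
    (DomE A : set (T -> R))
    (E : (T -> R) -> (T -> R) -> R)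
    (Gamma : (T -> R) -> (T -> R) -> (T -> R)).
Hypotheses
    (hDomL0 : DomE `<=` L0)
    (hADom : A `<=` DomE)
    (hGamma : nonneg_symmetric_operator A Gamma)
    (hEGamma : represents mu A Gamma E)
    (hypA : assumptionA DomE E)
    (hypB : assumptionB mu DomE A Gamma E).
Variables (a s : R) (alpha : R -> R).
Hypotheses (ha : 0 < a) (hs : 0 <= s)
    (halpha : forall p : R, 1 < p <= 2 -> a * (p - 1) `^ s <= alpha p)
    (hBeckner : forall p : R, 1 < p <= 2 -> beckner mu DomE E p (alpha p)).

(** Assumption B is used with [gamma = q - 1] and [t = q / 2]: the conjugate exponent [q / (q - 2)]
    turns the norm of [g ^ (q - 2)] into a power of the moment of order [q]. [G] is any positive
    bound on the norm of [Gamma f f] of order [q / 2]. *)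
Lemma moment_recursion f (c q G : R) : A f -> bounded_fun f -> 2 < q -> 0 < G ->
  (\int[mu]_x (Gamma f f x `^ (q / 2))%:E <= (G `^ (q / 2))%:E)%E ->
  (\int[mu]_x (`|f x + c| `^ q)) -
    (\int[mu]_x (`|f x + c| `^ (q - 1))) `^ (q / (q - 1)) <=
  q * (q - 1) `^ s * G / a * (\int[mu]_x (`|f x + c| `^ q)) `^ ((q - 2) / q).
Proof.
move=> Af bf q2 G0 hG.
have q0 : 0 < q by lra.
have q1 : 0 < q - 1 by lra.
have q2' : 0 < q - 2 by lra.
pose g : T -> R := fun x => `|f x + c|.
have g0 x : 0 <= g x by exact: normr_ge0.
have mg : measurable_fun [set: T] g.
  by apply: measurableT_comp => //; apply: measurable_funD => //; exact/hDomL0/hADom.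
have Gm0 x : 0 <= Gamma f f x by case: hGamma => _ _; exact.
have [K fK] := bounded_funW bf.
have ig (p : R) : 0 < p -> mu.-integrable [set: T] (EFin \o (fun x => g x `^ p)).
  move=> p0; apply: (@bounded_integrable _ _ _ _ _ ((K + `|c|) `^ p)).
    exact: (measurableT_comp (measurable_powR p)).
  move=> x; have gK : g x <= K + `|c| by rewrite (le_trans (ler_normD _ _))// lerD2r.
  rewrite [leLHS]ger0_norm ?powR_ge0//.
  by rewrite ge0_ler_powR ?nnegrE ?(ltW p0)// (le_trans _ gK).
set M := \int[mu]_x _; set M' := \int[mu]_x _.
have M0 : 0 <= M by apply: Rintegral_ge0 => x _; exact: powR_ge0.
have ME : (\int[mu]_x (g x `^ q)%:E)%E = M%:E by rewrite EFin_Rintegral//; exact: ig.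
have q21 : 1 <= q / 2 by rewrite ler_pdivlMr//; lra.
have q11 : 1 < q - 1 by lra.
have hcE : hoelder_conjugate (q / 2)%:E = (q / (q - 2))%:E.
  rewrite /hoelder_conjugate /= eqe gt_eqF ?divr_gt0//.
  rewrite -EFinB inver gt_eqF; last lra.
  by rewrite -EFinM; congr EFin; field; rewrite !gt_eqF//; lra.
have N1E : 'N[mu]_(hoelder_conjugate (q / 2)%:E)
    [EFin \o (fun x => g x `^ (q - 1 - 1))%R]%E = (M `^ ((q - 2) / q))%:E.
  rewrite hcE LnormE => [|x]; last exact: powR_ge0.
  under eq_integral => x _.
    rewrite -powRrM (_ : (q - 1 - 1) * (q / (q - 2)) = q); last first.
      by field; rewrite gt_eqF.
    over.
  by rewrite ME poweR_EFin invf_div.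
have N2 : ('N[mu]_((q / 2)%:E)[EFin \o Gamma f f] <= G%:E)%E.
  by apply: Lnorm_le => //; [rewrite divr_gt0|exact: ltW].
have := hypB.1 f c (q - 1) (q / 2) Af bf q11 q21.
rewrite -/g N1E -EFinM.
set rhs := (_ * _)%E.
have hrhs : (rhs <= (2 * (q - 1) * M `^ ((q - 2) / q) * G)%:E)%E.
  by rewrite /rhs [leRHS]EFinM lee_wpmul2l// lee_fin !mulr_ge0 ?powR_ge0//; lra.
(* Finiteness of the right-hand side is what places [g ^ (q - 1)] and [g] in the domain, as the
   Beckner inequality requires. *)
have rhs_fin : rhs \is a fin_num.
  rewrite ge0_fin_numE ?(le_lt_trans hrhs) ?ltry//.
  by rewrite mule_ge0 ?Lnorm_ge0// lee_fin !mulr_ge0 ?powR_ge0//; lra.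
move=> /(_ rhs_fin)[[Dg1 Dg]] /le_trans /(_ hrhs); rewrite lee_fin => hE.
set p := q / (q - 1).
have p1E : p - 1 = (q - 1)^-1 by rewrite /p; field; rewrite gt_eqF.
have hp : 1 < p <= 2.
  by rewrite /p ltr_pdivlMr// ler_pdivrMr//; apply/andP; split; lra.
have gE : (fun x => (g x `^ (q - 1)) `^ (p - 1)) = g.
  by apply/funext => x; rewrite p1E -powRrM divff ?gt_eqF// powRr1.
have gqE x : (g x `^ (q - 1)) `^ p = g x `^ q.
  by rewrite -powRrM; congr (_ `^ _); rewrite /p; field; rewrite gt_eqF.
have := hBeckner hp Dg1 (fun x => powR_ge0 _ _).
rewrite gE => /(_ Dg)[_ _].
under eq_Rintegral do rewrite gqE.
rewrite -/M -/M' => hBk.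
set X := M - _.
have RHS0 : 0 <= q * (q - 1) `^ s * G / a * M `^ ((q - 2) / q).
  by rewrite !mulr_ge0 ?powR_ge0 ?invr_ge0 ?(ltW q0) ?(ltW G0) ?(ltW ha).
(* The lower bound on [alpha p] can be multiplied by [X] only if [X >= 0]; otherwise the claim is
   trivial. *)
have [X0|X0] := ltP X 0; first exact: le_trans (ltW X0) RHS0.
have hX : a * (p - 1) `^ s * X <= q * M `^ ((q - 2) / q) * G.
  apply: (le_trans (ler_wpM2r X0 (halpha hp))).
  apply: (le_trans hBk).
  apply: (@le_trans _ _ (p / 2 * (2 * (q - 1) * M `^ ((q - 2) / q) * G))).
    by apply: ler_wpM2l hE; rewrite divr_ge0 ?ler0n// /p divr_ge0 ?ltW.
  by rewrite le_eqVlt; apply/orP; left; apply/eqP; rewrite /p; field; rewrite gt_eqF.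
(* Source of the factor [(q - 1) ^ s]: the lower bound on [alpha p] is taken at
   [p - 1 = 1 / (q - 1)]. *)
have qs : (p - 1) `^ s = ((q - 1) `^ s)^-1.
  by rewrite p1E -powR_inv1 ?(ltW q1)// -powRrM mulN1r powRN.
move: hX; rewrite qs mulrAC ler_pdivrMr ?powR_gt0// mulrC -ler_pdivlMr//.
move=> /le_trans; apply; rewrite le_eqVlt; apply/orP; left; apply/eqP.
by field; rewrite gt_eqF.
Qed.

Lemma alpha2_ge : a <= alpha 2.
Proof.
have := @halpha 2; rewrite (_ : 2 - 1 = 1); last by ring.
by rewrite powR1 mulr1; apply; rewrite lexx andbT ltr1n.
Qed.

Lemma beckner2 : beckner mu DomE E 2 (alpha 2).
Proof. by apply: hBeckner; rewrite lexx andbT ltr1n. Qed.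

(** Induction over real orders [q] in [[1, r]], in unit steps, for the bound [b q]. The base range
    is [[1, 2]], so that for [q > 2] the order [q - 1] is still in [[1, r]]. *)
Lemma bounded_moment_bound f (r G : R) : A f -> bounded_fun f -> 2 <= r -> 0 < G ->
  (\int[mu]_x (Gamma f f x `^ (r / 2))%:E <= (G `^ (r / 2))%:E)%E ->
  (\int[mu]_x (`|f x - \int[mu]_y f y| `^ r)%:E <=
   ((r `^ (s + 1) * kappa s / a * G) `^ (r / 2))%:E)%E.
Proof.
move=> Af bf r2 G0 hG.
have Gm0 x : 0 <= Gamma f f x by case: hGamma => _ _; exact.
have mGm : measurable_fun [set: T] (Gamma f f) by case: hGamma => h _ _; exact: h.
(* By monotonicity of norms the same [G] serves every order up to [r]. *)
have hGq (q : R) : 0 < q <= r ->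
    (\int[mu]_x (Gamma f f x `^ (q / 2))%:E <= (G `^ (q / 2))%:E)%E.
  move=> /andP[q0 qr]; apply: moment_le hG => //.
  by rewrite divr_gt0// ler_pM2r.
have s0 : 0 <= s := hs.
set m := \int[mu]_y f y.
have mf : measurable_fun [set: T] f by exact/hDomL0/hADom.
pose g : T -> R := fun x => `|f x - m|.
have g0 x : 0 <= g x by exact: normr_ge0.
have mg : measurable_fun [set: T] g.
  by apply: measurableT_comp => //; exact: measurable_funB.
have [K fK] := bounded_funW bf.
have ig (p : R) : 0 < p -> mu.-integrable [set: T] (EFin \o (fun x => g x `^ p)).
  move=> p0; apply: (@bounded_integrable _ _ _ _ _ ((K + `|m|) `^ p)).
    exact: (measurableT_comp (measurable_powR p)).
  move=> x; have gK : g x <= K + `|m|.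
    by rewrite (le_trans (ler_normB _ _))// lerD2r.
  rewrite [leLHS]ger0_norm ?powR_ge0//.
  by rewrite ge0_ler_powR ?nnegrE ?(ltW p0)// (le_trans _ gK).
have k1 := kappa_ge1 hs; have k0 : 0 < kappa s by exact: lt_le_trans k1.
pose b (q : R) := q `^ (s + 1) * kappa s / a * G.
have b0 (q : R) : 0 < q -> 0 < b q.
  by move=> q0; rewrite !mulr_gt0 ?k0 ?powR_gt0 ?invr_gt0.
have GaE (q : R) : 0 < q -> (G / a) `^ (q / 2) = Num.sqrt (G / a) `^ q.
  move=> q0; rewrite -powR12_sqrt -?powRrM; last by rewrite divr_ge0 ?ltW.
  by rewrite [2^-1 * _]mulrC.
(* The spectral gap bounds the second moment by [G / a], which controls the lower orders; moreover
   [b q >= G / a], as [q ^ (s + 1)] and [kappa s] are at least [1]. *)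
have base (q : R) : 1 <= q <= 2 -> (\int[mu]_x (g x `^ q)%:E <= (b q `^ (q / 2))%:E)%E.
  move=> /andP[q1 q2]; have q0 : 0 < q by exact: lt_le_trans q1.
  apply: (@le_trans _ _ (Num.sqrt (G / a) `^ q)%:E).
    apply: (@moment_le _ _ _ _ _ _ _ 2) => //.
    - by rewrite sqrtr_gt0 divr_gt0.
    - by rewrite q0.
    rewrite -GaE// divff ?pnatr_eq0// powRr1 ?divr_ge0 ?(ltW G0) ?(ltW ha)//.
    rewrite -EFin_Rintegral; last exact: ig.
    rewrite lee_fin; under eq_Rintegral do rewrite powR_mulrn// real_normK ?num_real//.
    apply: (le_trans (bounded_spectral_gap hDomL0 hypA ha alpha2_ge beckner2
      (hADom Af) fK)).
    rewrite ler_pM2r ?invr_gt0//.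
    have [iGm ->] := hEGamma Af Af.
    rewrite -lee_fin EFin_Rintegral//.
    have := @hGq 2; rewrite divff ?pnatr_eq0// powRr1 ?(ltW G0)//.
    rewrite r2 andbT ltr0n => /(_ isT).
    by under eq_integral do rewrite powRr1//.
  rewrite lee_fin -GaE// ge0_ler_powR ?nnegrE ?(ltW (b0 _ q0)) ?divr_ge0
    ?(ltW q0) ?(ltW G0) ?(ltW ha)//.
  have -> : b q = q `^ (s + 1) * kappa s * (G / a).
    by rewrite /b; field; rewrite gt_eqF.
  rewrite ler_peMl ?divr_ge0 ?(ltW G0) ?(ltW ha)//.
  rewrite -[1]mulr1 ler_pM//.
  by rewrite -[leLHS](powRr0 q) ler_powR//; lra.
(* Since [q] is real, the induction runs on a natural number above it; each step lowers both by
   one. *)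
suff H n (q : R) : 1 <= q <= r -> q <= n%:R ->
    (\int[mu]_x (g x `^ q)%:E <= (b q `^ (q / 2))%:E)%E.
  apply: (H (Num.Def.archi_bound r)); first by rewrite lexx andbT; lra.
  by apply/ltW/archi_boundP; lra.
elim: n q => [q /andP[q1 _] /(le_trans q1)|n IH q /andP[q1 qr] qn].
  by rewrite ler10.
have [q2|q2] := leP q 2; first by apply: base; rewrite q1.
have q0 : 0 < q by lra.
have ME (p : R) : 0 < p -> (\int[mu]_x (g x `^ p)%:E)%E = (\int[mu]_x (g x `^ p))%:E.
  by move=> p0; rewrite EFin_Rintegral//; exact: ig.
have : (\int[mu]_x (g x `^ (q - 1))%:E <= (b (q - 1) `^ ((q - 1) / 2))%:E)%E.
  apply: IH; first by apply/andP; split; lra.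
  by rewrite lerBlDr natr1.
rewrite !ME; [|lra|lra]; rewrite !lee_fin => hM'.
apply: (moment_step q2 hs (b0 _ q0) _ _ _ hM' (moment_recursion (- m) Af bf q2 G0 _)).
- rewrite /b powRM ?invr_ge0; [|lra|lra].
  have -> : q^-1 `^ (s + 1) = (q `^ (s + 1))^-1.
    by rewrite -[q^-1]powR_inv1 ?(ltW q0)// -powRrM mulN1r powRN.
  by field; rewrite !gt_eqF ?powR_gt0.
- by apply: Rintegral_ge0 => x _; exact: powR_ge0.
- by apply: Rintegral_ge0 => x _; exact: powR_ge0.
- by apply: hGq; rewrite q0.
(* The factor [1 - e] is the inverse of [kappa s] and cancels the one in [b q]; what remains is
   [(q - 1) ^ s <= q ^ s]. *)
rewrite -[X in X * b q]invrK -/(kappa s) /b; apply/andP; split.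
  by rewrite !mulr_ge0 ?powR_ge0 ?invr_ge0 ?(ltW q0) ?(ltW G0) ?(ltW ha).
have kn : kappa s != 0 by rewrite gt_eqF.
have -> : (kappa s)^-1 * (q `^ (s + 1) * kappa s / a * G) = q `^ (s + 1) * G / a.
  by field; rewrite kn gt_eqF.
rewrite !ler_pM2r ?invr_gt0// powRD ?powRr1 ?(ltW q0)//; last first.
  by rewrite (gt_eqF q0) implybT.
rewrite mulrC ler_pM2r// ge0_ler_powR ?nnegrE//; lra.
Qed.

End bounded.

(** * Limits of powers, of means and of integrals *)

Lemma cvg_powR (R : realType) (u : nat -> R) (l r : R) : 0 < r ->
  (forall n, 0 <= u n) -> u @ \oo --> l ->
  (fun n => u n `^ r) @ \oo --> l `^ r.
Proof.
move=> r0 u0 ul.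
have l0 : 0 <= l.
  by rewrite -(cvg_lim _ ul)//; apply: limr_ge; [apply/cvg_ex; exists l|exact: nearW].
(* The formula [exp (r * ln x)] fails at [0], so a zero limit is treated directly, with threshold
   [e ^ (1 / r)]. *)
have [l_gt0|] := ltP 0 l; last first.
  move=> l_le0; have -> : l = 0 by apply/eqP; rewrite eq_le l_le0.
  rewrite powR0 ?gt_eqF//; apply/cvgrPdist_lt => e e0.
  have le0 : l = 0 by apply/eqP; rewrite eq_le l_le0.
  move/cvgrPdist_lt : ul => /(_ (e `^ r^-1)); rewrite powR_gt0// => /(_ isT).
  apply: filterS => n; rewrite le0 !sub0r !normrN !ger0_norm ?powR_ge0// => un.
  have -> : e = (e `^ r^-1) `^ r.
    by rewrite -powRrM mulVf ?gt_eqF// powRr1// ltW.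
  by rewrite gt0_ltr_powR ?nnegrE ?powR_ge0.
have lE : l `^ r = expR (r * ln l) by rewrite /powR gt_eqF.
have uE : \forall n \near \oo, expR (r * ln (u n)) = u n `^ r.
  have ul_gt0 : \forall n \near \oo, 0 < u n by exact: cvgr_gt ul _ l_gt0.
  by apply: filterS ul_gt0 => n un; rewrite /powR gt_eqF.
rewrite lE; apply: cvg_trans; first exact: near_eq_cvg uE.
apply: (@continuous_cvg _ _ _ _ _ (fun n => r * ln (u n)) (@expR R)).
  exact: continuous_expR.
apply: (@cvgM _ _ _ _ (fun=> r)); first exact: cvg_cst.
by apply: (@continuous_cvg _ _ _ _ _ u (@ln R)) => //; exact: continuous_ln.
Qed.

Section limit.
Context d (T : measurableType d) (R : realType) (mu : probability T R).

(** The means are not assumed bounded. Truncations have means tending to [0] by dominated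
    convergence, and the variance bound limits what truncation hides: with [c] the mean of [v n],
    [min c K] is at most the mean truncated at [2 * K] plus [V / K]. *)
Lemma cvg_mean0 (v : nat -> T -> R) (V : R) :
  (forall n x, 0 <= v n x) ->
  (forall n, mu.-integrable [set: T] (EFin \o v n)) ->
  (forall n, mu.-integrable [set: T]
     (EFin \o (fun x => (v n x - \int[mu]_y v n y) ^+ 2))) ->
  (forall n, \int[mu]_x (v n x - \int[mu]_y v n y) ^+ 2 <= V) ->
  (\forall x \ae mu, v n x @[n --> \oo] --> (0 : R)) ->
  \int[mu]_x v n x @[n --> \oo] --> (0 : R).
Proof.
move=> v0 iv iv2 hV v_cvg.
have V0 : 0 <= V.
  by apply: le_trans (hV 0%N); apply: Rintegral_ge0 => x _; exact: sqr_ge0.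
have mv n : measurable_fun [set: T] (v n) by exact/measurable_EFinP/measurable_int/iv.
have mw (K : R) n : measurable_fun [set: T] (fun x => Num.min (v n x) K).
  exact: measurable_minr.
have w_bound (K : R) n x : 0 <= K -> `|Num.min (v n x) K| <= K.
  by move=> K0; rewrite ger0_norm ?ge_min ?lexx ?orbT// le_min v0.
have w_cvg (K : R) : 0 <= K ->
    \int[mu]_x (Num.min (v n x) K) @[n --> \oo] --> (0 : R).
  move=> K0.
  have [] := @dominated_convergence _ _ _ mu _ measurableT
    (fun n => EFin \o (fun x => Num.min (v n x) K)) (cst 0%E) (cst K%:E).
  - by move=> n; exact/measurable_EFinP.
  - exact: measurable_cst.
  - apply: filterS v_cvg => x vx _; apply: cvg_EFin; first exact: nearW.
    apply: (squeeze_cvgr _ (cvg_cst (0 : R)) vx); apply: nearW => n /=.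
    by rewrite ge_min lexx le_min v0 K0.
  - exact: finite_measure_integrable_cst.
  - by apply: aeW => x n _; rewrite /= lee_fin w_bound.
  move=> _ _; rewrite integral0 => /fine_cvg; exact.
apply/cvgrPdist_lt => e e0.
(* Chosen so that [V / K < e / 2], while [e <= K] lets [min c K < e] yield [c < e]. *)
pose K := e + 2 * V / e.
have K0 : 0 < K by rewrite ltr_wpDr// !mulr_ge0 ?invr_ge0// ltW.
have eK : e <= K by rewrite lerDl !mulr_ge0 ?invr_ge0// ltW.
have VK : V / K < e / 2.
  rewrite ltr_pdivrMr// /K mulrDr (_ : e / 2 * (2 * V / e) = V).
    by rewrite ltrDr mulr_gt0// divr_gt0.
  by field; rewrite gt_eqF.
have e20 : 0 < e / 2 by rewrite divr_gt0.
have K20 : 0 <= 2 * K by rewrite mulr_ge0// ltW.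
move/cvgrPdist_lt : (w_cvg _ K20) => /(_ _ e20).
apply: filterS => n; rewrite !sub0r !normrN.
rewrite !ger0_norm; last 2 first.
- by apply: Rintegral_ge0 => x _; exact: v0.
- by apply: Rintegral_ge0 => x _; rewrite le_min v0.
set c := \int[mu]_x v n x => hw.
have c0 : 0 <= c by apply: Rintegral_ge0 => x _; exact: v0.
(* Quadratic control of the truncation error of [v n - c] at level [K]. *)
have pw x : Num.min c K <=
    Num.min (v n x) (2 * K) + (c - v n x) + K^-1 * (v n x - c) ^+ 2.
  set y := v n x; have y0 : 0 <= y by exact: v0.
  set z := K^-1 * _.
  have Kz : K * z = (y - c) ^+ 2 by rewrite /z mulrA divff ?mul1r ?gt_eqF.
  have z0 : 0 <= z by rewrite mulr_ge0 ?sqr_ge0// invr_ge0 ltW.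
  (* Completing a square. Above the truncation level this leaves at least [2 * K - K / 4], which
     exceeds [K]; below it [z0] suffices. *)
  have zl : y - c - K / 4 <= z.
    rewrite -(ler_pM2l K0) Kz -subr_ge0.
    have -> : (y - c) ^+ 2 - K * (y - c - K / 4) = (y - c - K / 2) ^+ 2 by field.
    exact: sqr_ge0.
  have [yK|yK] := leP y (2 * K).
    rewrite ge_min; apply/orP; left; lra.
  rewrite ge_min; apply/orP; right; lra.
have ic (k : R) : mu.-integrable [set: T] (EFin \o (fun=> k)).
  exact: finite_measure_integrable_cst.
have iw : mu.-integrable [set: T] (EFin \o (fun x => Num.min (v n x) (2 * K))).
  by apply: (bounded_integrable mu (K := 2 * K) (mw _ _)) => x; exact: w_bound.
have i1 : mu.-integrable [set: T] (EFin \o (fun x => c - v n x)).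
  by have := integrableB measurableT (ic c) (iv n).
have i2 : mu.-integrable [set: T]
    (EFin \o (fun x => Num.min (v n x) (2 * K) + (c - v n x))).
  by have := integrableD measurableT iw i1.
have i3 : mu.-integrable [set: T] (EFin \o (fun x => K^-1 * (v n x - c) ^+ 2)).
  by have := integrableZl measurableT K^-1 (iv2 n).
have i4 : mu.-integrable [set: T]
    (EFin \o (fun x => Num.min (v n x) (2 * K) + (c - v n x) + K^-1 * (v n x - c) ^+ 2)).
  by have := integrableD measurableT i2 i3.
have := le_Rintegral measurableT (ic (Num.min c K)) i4 (fun x _ => pw x).
rewrite RintegralD// RintegralD// RintegralB// RintegralZl//.
rewrite !Rintegral_probability_cst -/c subrr addr0.
have hVK : K^-1 * \int[mu]_x (v n x - c) ^+ 2 <= V / K.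
  by rewrite mulrC ler_pM2r ?invr_gt0//; exact: hV.
rewrite ge_min => /orP[|]; lra.
Qed.

Lemma fatou_ae_le (h_ : nat -> T -> R) (h : T -> R) (C : \bar R) :
  (forall n x, 0 <= h_ n x) -> (forall x, 0 <= h x) ->
  (forall n, measurable_fun [set: T] (h_ n)) -> measurable_fun [set: T] h ->
  (\forall x \ae mu, h_ n x @[n --> \oo] --> h x) ->
  (forall n, \int[mu]_x (h_ n x)%:E <= C)%E -> (\int[mu]_x (h x)%:E <= C)%E.
Proof.
move=> hn0 h0 mhn mh h_cvg hC.
have mE n : measurable_fun [set: T] (EFin \o h_ n) by exact/measurable_EFinP.
have einfs_le (u : (\bar R)^nat) k : (einfs u k <= u k)%E.
  by apply: ereal_inf_lbound; exists k => /=.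
apply: (@le_trans _ _ (\int[mu]_x limn_einf (fun n => (h_ n x)%:E))%E).
  apply: ae_ge0_le_integral => //.
  - by move=> x _; rewrite lee_fin.
  - exact/measurable_EFinP.
  - move=> x _; rewrite limn_einf_lim; apply: lime_ge; first exact: is_cvg_einfs.
    by apply: nearW => n; apply: le_ereal_inf_tmp => _ [m _ <-]; rewrite lee_fin.
  - apply: measurableT_comp => //; apply: measurable_fun_limn_esup => n.
    exact: measurableT_comp (mE n).
  (* The lower limit equals [h] only almost everywhere; elsewhere its nonnegativity is enough. *)
  - apply: filterS h_cvg => x hx _.
    have /cvg_limn_einf_sup[-> _] // : (h_ n x)%:E @[n --> \oo] --> (h x)%:E.
    by apply: cvg_EFin => //; exact: nearW.
apply: le_trans (fatou _ _ mE _) _ => //; first by move=> n x _ /=; rewrite lee_fin.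
rewrite limn_einf_lim; apply: lime_le; first exact: is_cvg_einfs.
by apply: nearW => n; apply: le_trans (hC n); exact: einfs_le.
Qed.

End limit.

(** * From bounded functions to all of [A] *)

Lemma subspaceB d (T : measurableType d) (R : realType) (A : set (T -> R)) f g :
  linear_subspace A -> A f -> A g -> A (fun x => g x - f x).
Proof.
move=> [_ hA] Af Ag.
have -> : (fun x => g x - f x) = -1 *: f + g.
  by apply/funext => x; rewrite fctE /= scaleN1r addrC.
by apply/set_mem/hA; exact: mem_set.
Qed.

(** The parallelogram identity, with the nonnegative energy of [f + g] dropped. *)
Lemma form_subB_le d (T : measurableType d) (R : realType) (D : set (T -> R))
    (E : (T -> R) -> (T -> R) -> R) f g :
  linear_subspace D -> nonneg_symmetric_form D E -> D f -> D g ->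
  E (fun x => g x - f x) (fun x => g x - f x) <= 2 * (E f f + E g g).
Proof.
move=> hD [[symE linE] E0] Df Dg.
have lin (c : R) : D (c *: f + g) /\
    E (c *: f + g) (c *: f + g) = c ^+ 2 * E f f + 2 * c * E f g + E g g.
  have Du : D (c *: f + g) by apply/set_mem/hD.2; exact: mem_set.
  split=> //; rewrite linE// [E f _]symE// [E g _]symE// !linE//.
  by rewrite [E g f]symE// /GRing.scale/=; ring.
have -> : (fun x => g x - f x) = -1 *: f + g.
  by apply/funext => x; rewrite fctE /= scaleN1r addrC.
have [_ ->] := lin (-1); have [Dp Ep] := lin 1.
by have := E0 _ Dp; rewrite Ep; lra.
Qed.

Theorem proposition3p3 (d : measure_display) (T : measurableType d)
    (R : realType) (mu : probability T R)
    (DomE A : set (T -> R))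
    (E : (T -> R) -> (T -> R) -> R)
    (Gamma : (T -> R) -> (T -> R) -> (T -> R))
    (hDomL0 : DomE `<=` L0)
    (hDom : linear_subspace DomE)
    (hE : nonneg_symmetric_form DomE E)
    (hADom : A `<=` DomE)
    (hA : linear_subspace A)
    (hGamma : nonneg_symmetric_operator A Gamma)
    (hEGamma : represents mu A Gamma E)
    (hypA : assumptionA DomE E)
    (hypB : assumptionB mu DomE A Gamma E)
    (a s : R) (ha : 0 < a) (hs : 0 <= s)
    (alpha : R -> R)
    (halpha : forall p : R, 1 < p <= 2 -> a * (p - 1) `^ s <= alpha p)
    (hBeckner : forall p : R, 1 < p <= 2 -> beckner mu DomE E p (alpha p)) :
  forall (f : T -> R) (r : R), A f -> 2 <= r ->
    estimate (mu.-integrable [set: T] (EFin \o f))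
      ('N[mu]_(r%:E)[EFin \o (fun x => f x - \int[mu]_y f y)%R] ^+ 2)%E
      ((r `^ (s + 1) * kappa s / a)%:E *
       'N[mu]_((r / 2)%:E)[EFin \o Gamma f f])%E.
Proof.
move=> f r Af r2.
have r0 : 0 < r by lra.
have Gm0 g x : A g -> 0 <= Gamma g g x by case: hGamma => _ _ h Ag; exact: h.
have mGm g : A g -> measurable_fun [set: T] (Gamma g g).
  by case: hGamma => h _ _ Ag; exact: h.
have gap := ge0_spectral_gap ha (alpha2_ge halpha) (beckner2 hBeckner).
have Df := hADom _ Af; have mf : measurable_fun [set: T] f by exact: hDomL0.
(* Integrability is part of the Beckner inequality, applied at [p = 2] to [|f|], a contraction of
   [f]. *)
have intf : mu.-integrable [set: T] (EFin \o f).
  have [inf _ _] := gap _ (Dom_norm hypA Df) (fun x => normr_ge0 _).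
  apply: (le_integrable measurableT _ _ inf); first exact/measurable_EFinP.
  by move=> x _ /=; rewrite normr_id.
rewrite /estimate; set C := _ * _ / a; set N := Lnorm _ _ _ => hfin.
have C0 : 0 < C.
  by rewrite divr_gt0// mulr_gt0 ?powR_gt0// (lt_le_trans _ (kappa_ge1 hs)).
have N0 : (0 <= N)%E by exact: Lnorm_ge0.
(* As [C > 0], an infinite norm would make the right-hand side infinite. *)
have Nfin : N \is a fin_num.
  move: N0 hfin; case: N => //= _; by rewrite gt0_muley ?lte_fin.
split=> //.
set G0 := fine N; have NE : N = G0%:E by rewrite fineK.
have G00 : 0 <= G0 by exact: fine_ge0.
have intG : (\int[mu]_x (Gamma f f x `^ (r / 2))%:E = (G0 `^ (r / 2))%:E)%E.
  rewrite -poweR_EFin -NE /N poweR_Lnorm ?gt_eqF ?divr_gt0//.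
  by apply: eq_integral => x _ /=; rewrite ger0_norm ?Gm0.
have [fn [/all_and2[Afn bfn] fn_cvg Gfn]] := hypB.2 f Af.
have mfn n : measurable_fun [set: T] (fn n) by exact/hDomL0/hADom.
have intfn n : mu.-integrable [set: T] (EFin \o fn n).
  by have [K /bounded_integrable] := bounded_funW (bfn n); exact.
pose v n x := `|fn n x - f x|.
have Du n : DomE (fun x => fn n x - f x) by apply: subspaceB => //; exact: hADom.
have Dv n : DomE (v n) by exact: Dom_norm hypA _ (Du n).
have Efn n : E (fn n) (fn n) <= E f f.
  have [i1 ->] := hEGamma _ _ (Afn n) (Afn n); have [i2 ->] := hEGamma _ _ Af Af.
  rewrite -lee_fin !EFin_Rintegral//; apply: ae_ge0_le_integral => //.
  - by move=> x _; rewrite lee_fin Gm0.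
  - exact/measurable_EFinP/mGm.
  - by move=> x _; rewrite lee_fin Gm0.
  - exact/measurable_EFinP/mGm.
  - by apply: filterS (Gfn n) => x + _; rewrite lee_fin.
(* The energy of [fn n - f] is at most [2 * (E f f + E (fn n) (fn n))], hence at most [4 * E f f],
   uniformly in [n]. The absolute value makes the spectral gap for unbounded nonnegative functions
   applicable. *)
have v_cvg0 : \int[mu]_x v n x @[n --> \oo] --> (0 : R).
  apply: (@cvg_mean0 _ _ _ _ _ (4 * E f f / a)) => [n x|n|n|n|].
  - exact: normr_ge0.
  - by have [] := gap _ (Dv n) (fun x => normr_ge0 _).
  - by have [] := gap _ (Dv n) (fun x => normr_ge0 _).
  - have [_ _ /le_trans] := gap _ (Dv n) (fun x => normr_ge0 _); apply.
    rewrite ler_pM2r ?invr_gt0//; apply: (le_trans (energy_norm hypA (Du n))).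
    apply: (le_trans (form_subB_le hDom hE Df (hADom _ (Afn n)))).
    by have := Efn n; lra.
  - apply: filterS fn_cvg => x /cvgrPdist_lt fx; apply/cvgrPdist_lt => e e0.
    by apply: filterS (fx e e0) => n; rewrite sub0r normrN normr_id distrC.
set m := \int[mu]_y f y.
pose mn n := \int[mu]_y fn n y.
have mn_cvg : mn n @[n --> \oo] --> m.
  move/cvgrPdist_lt : v_cvg0 => v_cvg0; apply/cvgrPdist_lt => e e0.
  apply: filterS (v_cvg0 e e0) => n; rewrite sub0r normrN => /(le_lt_trans _); apply.
  rewrite distrC -RintegralB// (le_trans _ (ler_norm _))//.
  apply: le_normr_Rintegral => //.
  by have := integrableB measurableT (intfn n) intf.
(* The bounded case needs a positive [G], whereas [G0] may vanish; hence any [G] above [G0]. *)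
have key G : G0 < G ->
    (\int[mu]_x (`|f x - m| `^ r)%:E <= ((C * G) `^ (r / 2))%:E)%E.
  move=> G0G; have G_gt0 : 0 < G by exact: le_lt_trans G0G.
  apply: (@fatou_ae_le _ _ _ mu (fun n x => `|fn n x - mn n| `^ r)).
  - by move=> n x; exact: powR_ge0.
  - by move=> x; exact: powR_ge0.
  - move=> n; apply: (measurableT_comp (measurable_powR r)).
    by apply: measurableT_comp => //; exact: measurable_funB.
  - apply: (measurableT_comp (measurable_powR r)).
    by apply: measurableT_comp => //; exact: measurable_funB.
  - apply: filterS fn_cvg => x fx; apply: cvg_powR => //.
    by apply: cvg_norm; exact: cvgB.
  - move=> n; apply: (bounded_moment_bound hDomL0 hADom hGamma hEGamma hypA hypB
      ha hs halpha hBeckner (Afn n) (bfn n) r2 G_gt0).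
    apply: (@le_trans _ _ (G0 `^ (r / 2))%:E).
      rewrite -intG; apply: ae_ge0_le_integral => //.
      + by move=> x _; rewrite lee_fin powR_ge0.
      + exact/measurable_EFinP/(measurableT_comp (measurable_powR _))/mGm.
      + by move=> x _; rewrite lee_fin powR_ge0.
      + exact/measurable_EFinP/(measurableT_comp (measurable_powR _))/mGm.
      + apply: filterS (Gfn n) => x hx _.
        by rewrite lee_fin ge0_ler_powR ?nnegrE ?Gm0// divr_ge0 ?ltW.
    by rewrite lee_fin ge0_ler_powR ?nnegrE ?divr_ge0 ?(ltW r0) ?(ltW G_gt0) ?(ltW G0G).
apply/lee_addgt0Pr => e e0; rewrite NE.
have eC : 0 < e / C by rewrite divr_gt0.
(* With this excess, [C * G] overshoots the target by exactly [e]. *)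
set G := G0 + e / C; have G0G : G0 < G by rewrite ltrDl.
have -> : (C%:E * G0%:E + e%:E = (C * G)%:E)%E.
  by rewrite -EFinM -EFinD /G; congr EFin; field; rewrite gt_eqF.
have CG0 : 0 <= C * G by rewrite mulr_ge0 ?(ltW C0)// ltW// (le_lt_trans G00).
have hN : ('N[mu]_r%:E[EFin \o (fun x => f x - m)%R] <= (Num.sqrt (C * G))%:E)%E.
  rewrite -Lnorm_abse; apply: (@Lnorm_le _ _ _ mu (fun x => `|f x - m|)) => //.
  rewrite -powR12_sqrt// -powRrM [_^-1 * _]mulrC; exact: key.
rewrite -[C * G]sqr_sqrtr// expr2 EFinM expe2 lee_pmul// Lnorm_ge0//.
Qed.
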